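(* Let $K$ be a finite pure $k$-dimensional simplicial complex ($k\ge 1$) on the vertex set $[n]=\{1,\dots,n\}$, with the vertices labelled so that $\deg_K(1)\ge \deg_K(2)\ge\cdots\ge\deg_K(n)$. Then $$\sum_{r\ge1}\bigl(d^{\mathrm v,\mathsf T}_r(K)\bigr)^2-\sum_r \lambda_r(K)^2 = 2\sum_{1\le i<j\le n}(N_{ij}-R_{ij}).$$ In particular, the second-moment gap on the left is twice the total number of failed elementary shifts of facets, i.e. twice the total number of triples $(i,j,\sigma)$ with $i<j$, $\sigma\in K_k$, $j\in\sigma$, $i\notin\sigma$ and $(\sigma\setminus\{j\})\cup\{i\}\notin K_k$.
   Context: A simplicial complex $K$ on a finite vertex set is a collection of subsets closed under taking subsets; a face with $m+1$ vertices has dimension $m$, and $K_j$ is the set of $j$-dimensional faces. $K$ is $k$-dimensional if $k$ is the largest dimension of a face, and pure if every face lies in a $k$-face. The $k$-faces are called facets. Choose an orientation (an ordering of the vertices, up to even permutations) of each face. The boundary matrix $B_k=([\sigma:F])_{\sigma\in K_{k-1},F\in K_k}$ has $[\sigma:F]=0$ if $\sigma\not\subset F$, and if $F=[v_0,\dots,v_k]$ and $\sigma=F\setminus\{v_i\}$ then $[\sigma:F]=(-1)^i\operatorname{sgn}(\pi)$, where $\pi$ is the permutation carrying $(v_0,\dots,\widehat{v_i},\dots,v_k)$ to the chosen ordering of $\sigma$. The up-Laplacian is $L^{\mathrm{up}}_{k-1}(K)=B_kB_k^{\mathsf T}$; its spectrum does not depend on the orientations. $\lambda_1(K)\ge\lambda_2(K)\ge\cdots>0$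 are its nonzero eigenvalues, counted with multiplicity. $\deg_K(v)=|\{\sigma\in K_k: v\in\sigma\}|$, and $d^{\mathrm v,\mathsf T}_r(K)=|\{i\in[n]:\deg_K(i)\ge r\}|$ for $r\ge1$. For $i<j$: $N_{ij}=|\{\sigma\in K_k: j\in\sigma,\ i\notin\sigma\}|$ (admissible shifts) and $R_{ij}=|\{\sigma\in K_k: j\in\sigma,\ i\notin\sigma,\ (\sigma\setminus\{j\})\cup\{i\}\in K_k\}|$ (successful shifts); $N_{ij}-R_{ij}$ counts failed shifts. *)

(* Defs.v *)
From mathcomp Require Import all_boot all_order all_fingroup all_algebra.
From mathcomp Require Import polyrcf.

Set Implicit Arguments.
Unset Strict Implicit.
Unset Printing Implicit Defensive.

Import Order.TTheory GRing.Theory Num.Theory.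
Local Open Scope ring_scope.

Section Complexes.
Context {n : nat}.
Implicit Types (K : {set {set 'I_n}}) (F G s : {set 'I_n}) (i j v : 'I_n).

Definition simplicial_complex K : Prop :=
  forall F G, F \in K -> G \subset F -> G \in K.

(* A face with m + 1 vertices has dimension m. *)
Definition faces K (m : nat) : {set {set 'I_n}} :=
  [set F in K | #|F| == m.+1].

Definition has_dimension K (k : nat) : Prop :=
  (exists F, F \in faces K k) /\ (forall F, F \in K -> (#|F| <= k.+1)%N).

Definition pure K (k : nat) : Prop :=
  forall F, F \in K -> exists2 G, G \in faces K k & F \subset G.

(* An orientation is given by a representative ordering [o F] of the vertices
   of each face [F]; replacing it by an even permutation does not change the
   incidence numbers below. *)
Definition is_orientation K (o : {set 'I_n} -> seq 'I_n) : Prop :=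
  forall F, F \in K -> uniq (o F) /\ o F =i F.

(* The sign of the permutation carrying the duplicate-free sequence [a] to its
   rearrangement [b]: it is realised as the unique permutation of the vertices
   supported on [a] that maps [a] to [b] itemwise. *)
Definition reorder_sgn (R : pzRingType) (a b : seq 'I_n) : R :=
  if [pick p : {perm 'I_n} | perm_on [set x in a] p && (map p a == b)]
    is Some p then (-1) ^+ odd_perm p else 0.

(* [index v (o F)] is the position i of v = v_i in F = [v_0, ..., v_k], and
   [rem v (o F)] is (v_0, ..., v_k) with v_i omitted.  When #|F| = #|s| + 1,
   a vertex v of F with s = F \ {v} exists exactly when s is included in F,
   and it is unique. *)
Definition incidence (R : pzRingType) (o : {set 'I_n} -> seq 'I_n) s F : R :=
  if [pick v in F | s == F :\ v] is Some v
  then (-1) ^+ index v (o F) * reorder_sgn R (rem v (o F)) (o s)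
  else 0.

(* Intended for k >= 1. *)
Definition boundary_mx (R : pzRingType) K (o : {set 'I_n} -> seq 'I_n)
    (k : nat) : 'M[R]_(#|faces K k.-1|, #|faces K k|) :=
  \matrix_(a, b) incidence R o (enum_val a) (enum_val b).

(* [up_laplacian R K o k] is the up-Laplacian in degree k - 1. *)
Definition up_laplacian (R : pzRingType) K (o : {set 'I_n} -> seq 'I_n)
    (k : nat) : 'M[R]_#|faces K k.-1| :=
  boundary_mx R K o k *m (boundary_mx R K o k)^T.

Definition vdeg K (k : nat) v : nat := #|[set F in faces K k | v \in F]|.

Definition vdeg_conj K (k r : nat) : nat :=
  #|[set v : 'I_n | (r <= vdeg K k v)%N]|.

Definition shift F i j : {set 'I_n} := i |: (F :\ j).

Definition admissible_shifts K (k : nat) i j : nat :=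
  #|[set F in faces K k | (j \in F) && (i \notin F)]|.

Definition successful_shifts K (k : nat) i j : nat :=
  #|[set F in faces K k |
      [&& j \in F, i \notin F & shift F i j \in faces K k]]|.

Definition failed_shifts K (k : nat) : {set 'I_n * 'I_n * {set 'I_n}} :=
  [set t : 'I_n * 'I_n * {set 'I_n} |
    let: (i, j, F) := t in
    [&& (i < j)%N, F \in faces K k, j \in F, i \notin F
      & shift F i j \notin faces K k]].

End Complexes.

(* The nonzero eigenvalues in R, in nonincreasing order, each repeated
   according to its multiplicity as a root of the characteristic polynomial. *)
Definition nonzero_eigenvalues (R : rcfType) (m : nat) (A : 'M[R]_m) : seq R :=
  sort >=%R
    (flatten [seq nseq (mup x (char_poly A)) x
             | x <- rootsR (char_poly A) & x != 0]).

(* Main.v *)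
(* Both moments are counts.  The trace of L^2, where L = B B^T, is that of
   (B^T B)^2: the diagonal entries of B^T B are k + 1, and an off-diagonal entry
   is 1 or -1 when the two facets share a ridge and 0 otherwise, so the sum of
   the lambda^2 is (k + 1)^2 f, with f the number of facets, plus the number of
   ordered pairs of adjacent facets, which is twice the number of successful
   shifts.  On the other side,
   the sum of the squared conjugate degrees is that of min(deg i, deg j) over
   ordered pairs, and deg j = N_ij + #{F : i, j in F} for i < j; the codegrees
   again contribute (k + 1)^2 f. *)

Require Import Defs.
From mathcomp Require Import all_boot all_order all_fingroup all_algebra.
From mathcomp Require Import polyrcf complex zify.

Set Implicit Arguments.
Unset Strict Implicit.
Unset Printing Implicit Defensive.

Import Order.TTheory GRing.Theory Num.Theory.
Local Open Scope ring_scope.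

(** * Spectra of real symmetric matrices *)

Lemma char_poly_conj (F : fieldType) m (P A : 'M[F]_m) :
  P \in unitmx -> char_poly (invmx P *m A *m P) = char_poly A.
Proof.
move=> Pu.
have eqP : map_mx (@polyC F) (invmx P) *m map_mx (@polyC F) P = 1%:M.
  by rewrite -map_mxM mulVmx // map_mx1.
rewrite /char_poly.
have -> : char_poly_mx (invmx P *m A *m P) =
    map_mx (@polyC F) (invmx P) *m char_poly_mx A *m map_mx (@polyC F) P.
  rewrite /char_poly_mx !map_mxM mulmxBr mulmxBl; congr (_ - _).
  by rewrite scalar_mxC -mulmxA eqP mulmx1.
by rewrite !det_mulmx mulrAC -det_mulmx eqP det1 mul1r.
Qed.

(* Over R[i] a real symmetric matrix is hermitian, hence unitarily
   diagonalizable with real eigenvalues. *)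
Lemma symmetric_spectrum (R : rcfType) m (A : 'M[R]_m) : A^T = A ->
  exists2 d : 'I_m -> R, char_poly A = \prod_i ('X - (d i)%:P)
                       & \tr (A *m A) = \sum_i d i ^+ 2.
Proof.
move=> Asym; pose f := real_complex R; pose Ac := map_mx f A.
have Ac_herm : Ac \is hermsymmx.
  apply: realsym_hermsym.
    by apply/is_hermitianmxP; rewrite expr0 scale1r map_mx_id // map_trmx Asym.
  apply/mxOverP => i j; rewrite mxE.
  by apply/complex_realP; exists (A i j).
have /mxOverP Dreal := hermitian_spectral_diag_real Ac_herm.
have /hermitian_normalmx /orthomx_spectralP := Ac_herm.
have := spectral_unit Ac.
set P := spectralmx Ac; set D := spectral_diag Ac => Pu AcE.
exists (fun i => complex.Re (D 0 i)).
  apply: (map_poly_inj f).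
  rewrite map_char_poly -/Ac AcE char_poly_conj //.
  rewrite char_poly_trig ?diag_mx_is_trig //.
  rewrite rmorph_prod; apply: eq_bigr => i _ /=.
  by rewrite map_polyXsubC /= RRe_real // mxE eqxx.
apply: (fmorph_inj f).
rewrite -trace_map_mx map_mxM -/Ac AcE !mulmxA mulmxK //.
rewrite mxtrace_mulC !mulmxA mulmxV // mul1mx /mxtrace rmorph_sum.
apply: eq_bigr => i _; rewrite rmorphXn /= RRe_real //.
by rewrite mul_diag_mx !mxE eqxx expr2.
Qed.

(** The characteristic polynomial splits over the list [s] of diagonal values, so the multiplicity
    of a root is its number of occurrences in [s]. Discarding the eigenvalue 0 does not affect a sum
    of squares. *)
Lemma sum_sqr_nonzero_eigenvalues (R : rcfType) m (A : 'M[R]_m) : A^T = A ->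
  \sum_(x <- nonzero_eigenvalues A) x ^+ 2 = \tr (A *m A).
Proof.
move=> /symmetric_spectrum[d pE ->].
rewrite /nonzero_eigenvalues (perm_big _ (permEl (perm_sort _ _))) /=.
rewrite big_flatten big_map big_filter.
pose s := [seq d i | i <- index_enum 'I_m].
have {}pE : char_poly A = \prod_(x <- s) ('X - x%:P) by rewrite pE big_map.
have p0 : char_poly A != 0 by rewrite monic_neq0 // char_poly_monic.
transitivity (\sum_(x <- s) x ^+ 2); last by rewrite big_map.
(* Group equal entries of [s], to match the repetition by multiplicity on the left. *)
rewrite -[RHS]big_undup_iterop_count /=.
rewrite [RHS](bigID (fun x => x != 0)) /=.
rewrite [X in _ = _ + X]big1 ?addr0; last first.
  move=> x; rewrite negbK => /eqP->; rewrite expr0n /=.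
  by rewrite Monoid.iteropE iter_addr_0 mul0rn.
rewrite -[LHS]big_filter -[RHS]big_filter.
rewrite (@perm_big _ _ _ _ _ [seq x <- undup s | x != 0]).
  apply: eq_bigr => x _; rewrite big_nseq pE mu_prod_XsubC.
  rewrite -[iter _ _ _]Monoid.iteropE; exact: erefl.
apply: perm_filter; apply: uniq_perm; rewrite ?undup_uniq ?uniq_roots //.
move=> x; rewrite mem_undup -(root_prod_XsubC s x) -pE.
by rewrite -(roots_on_rootsR p0) // in_itv.
Qed.

(** * Signs of reorderings *)

Lemma perm_map_ex (T : finType) (a b : seq T) :
  uniq a -> perm_eq a b ->
  exists2 p : {perm T}, perm_on [set x in a] p & map p a = b.
Proof.
move=> ua pab; have ub : uniq b by rewrite -(perm_uniq pab).
have sz := perm_size pab; have mab := perm_mem pab.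
(* [f] matches [a] with [b] index by index and fixes everything else. As it maps [a] into itself, an
   entry of [a] and a point outside [a] cannot have the same image. *)
pose f x := if x \in a then nth x b (index x a) else x.
have fa x : x \in a -> f x \in a.
  by move=> xa; rewrite /f xa mab mem_nth // -sz index_mem.
have fI : injective f.
  move=> x y; rewrite /f; case: ifP => xa; case: ifP => ya // fxy.
  - apply: (index_inj x xa ya); apply/eqP.
    rewrite -(nth_uniq x _ _ ub) -?sz ?index_mem //.
    by rewrite fxy (set_nth_default y) // -sz index_mem.
  - by move: (fa x xa); rewrite /f xa fxy ya.
  - by move: (fa y ya); rewrite /f ya -fxy xa.
exists (perm fI).
  apply/subsetP => x; rewrite !inE permE /f.
  by case: ifP => //; rewrite eqxx.
(* [nth] needs a default element; if [T] is empty, both lists are empty. *)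
have [x0 _|noT] := pickP (fun _ : T => true); last first.
  have nil (s : seq T) : s = [::] by case: s => // x; have := noT x.
  by rewrite (nil b); apply: nil.
apply: (@eq_from_nth _ x0); rewrite size_map // => i ilt.
rewrite (nth_map x0) // permE /f mem_nth // index_uniq //.
by apply: set_nth_default; rewrite -sz.
Qed.

(** Some suitable permutation exists, which excludes the default value 0; whichever one [pick]
    returns, its sign squares to 1. *)
Lemma reorder_sgn_sqr (R : pzRingType) n (a b : seq 'I_n) :
  uniq a -> perm_eq a b -> reorder_sgn R a b ^+ 2 = 1.
Proof.
move=> ua /(perm_map_ex ua)[p p_on pE]; rewrite /reorder_sgn.
case: pickP => [q _|/(_ p)]; first by rewrite sqrr_sign.
by rewrite p_on pE eqxx.
Qed.

Lemma setD1_inj (T : finType) (F : {set T}) :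
  {in F &, injective (fun v => F :\ v)}.
Proof.
move=> v w vF wF /= /setP/(_ v); rewrite !inE eqxx vF andbT.
by case: eqVneq.
Qed.

(** * The Gram matrix of the columns of the boundary matrix *)

Section Gram.
Variables (R : comNzRingType) (n k : nat) (K : {set {set 'I_n}}).
Variable o : {set 'I_n} -> seq 'I_n.
Hypotheses (k_ge1 : (1 <= k)%N) (K_complex : simplicial_complex K).
Hypothesis o_orient : is_orientation K o.

Lemma incidence_sqr F s : F \in K ->
  incidence R o s F ^+ 2 = (s \in [set F :\ v | v in F])%:R.
Proof.
move=> FK; rewrite /incidence; case: pickP => [v /andP[vF /eqP ->]|none].
  rewrite (imset_f (fun w => F :\ w)) //.
  rewrite exprMn_comm ?sqrr_sign ?mul1r; last exact: mulrC.
  have [uF oF] := o_orient FK.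
  have [us os] := o_orient (K_complex FK (subsetDl F [set v])).
  apply: reorder_sgn_sqr; first exact: rem_uniq.
  apply: uniq_perm => //; first exact: rem_uniq.
  by move=> x; rewrite mem_rem_uniq // os !inE oF.
case: imsetP => [[v vF sE]|]; last by rewrite expr0n.
by have := none v; rewrite vF sE eqxx.
Qed.

Lemma incidence_eq0 F s :
  s \notin [set F :\ v | v in F] -> incidence R o s F = 0.
Proof.
move=> sF; rewrite /incidence; case: pickP => // v /andP[vF /eqP sE].
by rewrite sE (imset_f (fun w => F :\ w)) in sF.
Qed.

Lemma facet_boundary F : F \in faces K k ->
  [set F :\ v | v in F] \subset faces K k.-1.
Proof.
rewrite inE => /andP[FK /eqP cF]; apply/subsetP => _ /imsetP[v vF ->].
rewrite inE (K_complex FK) ?subsetDl //=.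
by rewrite prednK //; move: cF; rewrite (cardsD1 v) vF add1n => -[->].
Qed.

(** Trades the existential description of ridges for a test on inclusion and size, which is
    convenient for intersections of facets. *)
Lemma mem_facet_ridges (F s : {set 'I_n}) : #|F| = k.+1 ->
  (s \in [set F :\ v | v in F]) = (s \subset F) && (#|s| == k).
Proof.
move=> cF; apply/imsetP/andP => [[v vF ->]|[sF /eqP cs]].
  rewrite subsetDl; split=> //.
  by move: cF; rewrite (cardsD1 v) vF add1n => -[->].
have /eqP/cards1P[v Ev] : #|F :\: s| = 1%N.
  by rewrite cardsD (setIidPr sF) cF cs subSnn.
exists v; first by have := set11 v; rewrite -Ev inE => /andP[].
by rewrite -Ev setDDr setDv set0U (setIidPr sF).
Qed.

(** The entries of $B^{\mathsf T}B$, indexed by the facets themselves instead of ordinals. *)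
Definition gram (F G : {set 'I_n}) : R :=
  \sum_(s in faces K k.-1) incidence R o s F * incidence R o s G.

Lemma gram_diag F : F \in faces K k -> gram F F = k.+1%:R.
Proof.
move=> Fk; have := Fk; rewrite inE => /andP[FK /eqP cF]; rewrite /gram.
rewrite (eq_bigr (fun s => (s \in [set F :\ v | v in F])%:R)); last first.
  by move=> s _; rewrite -expr2 incidence_sqr.
rewrite -natr_sum -big_mkcondr /= sum1_card; congr (_%:R).
(* Deleting distinct vertices leaves distinct ridges, so a facet has as many ridges as vertices. *)
rewrite -cF -(card_in_imset (@setD1_inj _ F)); apply: eq_card => s.
apply/andP/idP => [[]//|sF]; split=> //.
exact: (subsetP (facet_boundary Fk)).
Qed.

(** A common ridge has $k$ vertices and lies in $F\cap G$, which has at most $k$ since $F\ne G$.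
    Hence at most one term of the sum survives, and it is $\pm1$; squaring removes the dependence on
    the orientation. *)
Lemma gram_offdiag F G : F \in faces K k -> G \in faces K k -> F != G ->
  gram F G ^+ 2 = (#|F :&: G| == k)%:R.
Proof.
move=> Fk Gk FG; have := Fk; have := Gk.
rewrite !inE => /andP[GK /eqP cG] /andP[FK /eqP cF].
have cI : (#|F :&: G| <= k)%N.
  rewrite -ltnS -[X in (_ < X)%N]cF proper_card // properEneq subsetIl andbT.
  apply: contra FG => /eqP/setIidPl FsG.
  by rewrite eqEcard FsG cF cG leqnn.
have vanish s : s != F :&: G -> incidence R o s F * incidence R o s G = 0.
  move=> sFG.
  have [/incidence_eq0->|] := boolP (s \notin [set F :\ v | v in F]).
    by rewrite mul0r.
  rewrite negbK mem_facet_ridges // => /andP[sF /eqP cs].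
  have [/incidence_eq0->|] := boolP (s \notin [set G :\ v | v in G]).
    by rewrite mulr0.
  rewrite negbK mem_facet_ridges // => /andP[sG _]; case/negP: sFG.
  by rewrite eqEcard subsetI sF sG cs.
have [cFG|cFG] := eqVneq #|F :&: G| k; last first.
  rewrite /gram big1 ?expr0n // => s _.
  have [->|] := eqVneq s (F :&: G); last exact: vanish.
  by rewrite incidence_eq0 ?mul0r // mem_facet_ridges // negb_and cFG orbT.
have IF : F :&: G \in [set F :\ v | v in F].
  by rewrite mem_facet_ridges // subsetIl cFG /=.
have IG : F :&: G \in [set G :\ v | v in G].
  by rewrite mem_facet_ridges // subsetIr cFG /=.
have /subsetP/(_ _ IF) Ik := facet_boundary Fk.
rewrite /gram (bigD1 _ Ik) /= big1 ?addr0; last by move=> s /andP[_ /vanish].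
rewrite exprMn_comm; last exact: mulrC.
by rewrite !incidence_sqr // IF IG mulr1.
Qed.

Definition adjacent_facets F : {set {set 'I_n}} :=
  [set G in faces K k | (G != F) && (#|F :&: G| == k)].

Lemma trace_up_laplacian_sqr :
  \tr (up_laplacian R K o k *m up_laplacian R K o k) =
  (k.+1 ^ 2 * #|faces K k| + \sum_(F in faces K k) #|adjacent_facets F|)%:R.
Proof.
rewrite /up_laplacian; set B := boundary_mx R K o k.
rewrite -mulmxA mxtrace_mulC -!mulmxA mulmxA.
have BE a b : (B^T *m B) a b = gram (enum_val a) (enum_val b).
  rewrite /gram big_enum_val mxE; apply: eq_bigr => s _.
  by rewrite !mxE.
(* For a symmetric matrix, the trace of the square is the sum of the squared entries. *)
transitivity (\sum_(F in faces K k) \sum_(G in faces K k) gram F G ^+ 2).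
  rewrite big_enum_val /mxtrace; apply: eq_bigr => a _.
  rewrite big_enum_val mxE; apply: eq_bigr => b _.
  rewrite !BE expr2; congr (_ * _); rewrite /gram.
  by apply: eq_bigr => s _; rewrite mulrC.
rewrite natrD natrM mulr_natr -sumr_const natr_sum -big_split /=.
apply: eq_bigr => F Fk.
rewrite (bigD1 F Fk) gram_diag // natrX; congr (_ + _).
rewrite -sum1_card natr_sum.
under [RHS]eq_bigl => G do rewrite inE andbA.
rewrite [RHS]big_mkcondr; apply: eq_bigr => G /andP[Gk GF].
rewrite eq_sym in GF.
by rewrite gram_offdiag //; case: (_ == k).
Qed.

End Gram.

(** * Degrees and codegrees, summed over pairs of vertices *)

Lemma sum_symmetric n (f : 'I_n -> 'I_n -> nat) : (forall i j, f i j = f j i) ->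
  (\sum_i \sum_j f i j =
   \sum_i f i i + 2 * \sum_(i < n) \sum_(j < n | i < j) f i j)%N.
Proof.
move=> fC.
have split3 (i : 'I_n) : (\sum_j f i j =
    f i i + (\sum_(j < n | i < j) f i j + \sum_(j < n | j < i) f i j))%N.
  rewrite (bigD1 i) //=; congr addn.
  rewrite (bigID (fun j : 'I_n => (i < j)%N)) /=.
  congr addn; apply: eq_bigl => j; rewrite -(inj_eq val_inj) /=; lia.
rewrite (eq_bigr _ (fun i _ => split3 i)) !big_split /= mul2n -addnn.
congr (_ + (_ + _))%N.
rewrite (exchange_big_dep xpredT) //=; apply: eq_bigr => i _.
by apply: eq_bigr => j _; rewrite fC.
Qed.

Section FacetCounts.
Variables (n k : nat) (K : {set {set 'I_n}}).
Implicit Types (i j v : 'I_n) (F G : {set 'I_n}).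

Lemma vdeg_le v : (vdeg K k v <= #|faces K k|)%N.
Proof. by apply/subset_leq_card/subsetP => F; rewrite inE => /andP[]. Qed.

Definition codegree i j := #|[set F in faces K k | (i \in F) && (j \in F)]|.

Lemma codegreeE i j :
  codegree i j = (\sum_(F in faces K k) (i \in F) * (j \in F))%N.
Proof.
rewrite /codegree -sum1_card big_mkcond [RHS]big_mkcond /=.
apply: eq_bigr => F _; rewrite [_ \in [set _ in _ | _]]inE.
by case: (F \in _); case: (i \in F); case: (j \in F).
Qed.

(** Each facet is counted once for every ordered pair of its $k+1$ vertices, equal pairs
    included. *)
Lemma sum_codegree : (\sum_i \sum_j codegree i j = k.+1 ^ 2 * #|faces K k|)%N.
Proof.
under eq_bigr => i _ do under eq_bigr => j _ do rewrite codegreeE.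
under eq_bigr => i _ do rewrite exchange_big.
rewrite exchange_big /= mulnC -sum_nat_const; apply: eq_bigr => F.
rewrite inE => /andP[_ /eqP cF].
under eq_bigr => i _ do rewrite -big_distrr /=.
by rewrite -big_distrl /= -mulnn -cF -sum1_card -!big_mkcond.
Qed.

Lemma vdeg_split i j :
  vdeg K k j = (admissible_shifts K k i j + codegree i j)%N.
Proof.
rewrite /admissible_shifts /codegree /vdeg.
rewrite -(cardsID [set F : {set 'I_n} | i \in F]) addnC.
congr addn; apply: eq_card => F;
  by rewrite !inE; case: (i \in F); rewrite ?andbT ?andbF //= andbT.
Qed.

(** The square at $r$ counts the ordered pairs of vertices whose degrees are both at least $r$, so a
    pair is counted once for each $r$ from 1 to the smaller degree. *)
Lemma sum_vdeg_conj_sqr :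
  (\sum_(1 <= r < #|faces K k|.+1) vdeg_conj K k r ^ 2 =
   \sum_i \sum_j minn (vdeg K k i) (vdeg K k j))%N.
Proof.
have conjE r : vdeg_conj K k r = (\sum_i (r <= vdeg K k i))%N.
  rewrite /vdeg_conj -sum1_card big_mkcond /=.
  by apply: eq_bigr => v _; rewrite inE; case: leqP.
under eq_bigr => r _ do rewrite conjE -mulnn big_distrl /=.
under eq_bigr => r _ do under eq_bigr => i _ do rewrite big_distrr /=.
rewrite exchange_big /=; apply: eq_bigr => i _.
rewrite exchange_big /=; apply: eq_bigr => j _.
set t := minn _ _.
have tm : (t <= #|faces K k|)%N by rewrite geq_min vdeg_le.
under eq_bigr => r _ do rewrite mulnb -leq_min -/t.
(* Cut the range after $r=t$: the summand is 1 up to there and 0 beyond. *)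
rewrite (@big_cat_nat _ _ _ t.+1) //= ?ltnS //.
rewrite [X in (_ + X)%N]big_nat [X in (_ + X)%N]big1 ?addn0; last first.
  by move=> r /andP[tr _]; rewrite leqNgt tr.
rewrite big_nat (eq_bigr (fun=> 1%N)); last first.
  by move=> r /andP[_]; rewrite ltnS => ->.
by rewrite -big_nat sum_nat_const_nat subn1 muln1.
Qed.

Lemma sum_vdeg_conj_sqr_sorted :
  (forall i j, (i <= j)%N -> (vdeg K k j <= vdeg K k i)%N) ->
  (\sum_(1 <= r < #|faces K k|.+1) vdeg_conj K k r ^ 2 =
   k.+1 ^ 2 * #|faces K k|
   + 2 * \sum_(i < n) \sum_(j < n | i < j) admissible_shifts K k i j)%N.
Proof.
move=> sorted; rewrite sum_vdeg_conj_sqr sum_symmetric; last first.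
  by move=> i j; rewrite minnC.
(* Turning $(k+1)^2f$ back into a sum of codegrees allows a termwise comparison: on the diagonal the
   codegree is the degree, and for $i<j$ the minimum is $\deg j$ by sortedness. *)
rewrite -sum_codegree sum_symmetric; last first.
  by move=> i j; apply: eq_card => F; rewrite !inE [(j \in F) && _]andbC.
rewrite -addnA -mulnDr -big_split /=; congr (_ + 2 * _)%N.
  apply: eq_bigr => i _; rewrite minnn.
  by apply: eq_card => F; rewrite !inE andbb.
apply: eq_bigr => i _; rewrite -big_split /=; apply: eq_bigr => j ij.
rewrite (minn_idPr _) ?sorted 1?ltnW // (vdeg_split i).
by rewrite addnC.
Qed.

(** * Elementary shifts and adjacent facets *)

Lemma shiftK i j F : i \notin F -> j \in F -> shift (shift F i j) j i = F.
Proof.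
move=> iF jF; apply/setP => v; rewrite !inE.
case: (eqVneq v j) => [->|vj] //=; case: (eqVneq v i) => [->|vi] //=.
by rewrite (negPf iF).
Qed.

(** Shifting is injective on the successful facets, with the reverse shift as inverse, and its
    images are successful for the reversed pair. This gives both inequalities. *)
Lemma successful_shiftsC i j :
  successful_shifts K k i j = successful_shifts K k j i.
Proof.
have le a b : (successful_shifts K k a b <= successful_shifts K k b a)%N.
  rewrite /successful_shifts -(card_in_imset (f := fun F => shift F a b)).
    apply/subset_leq_card/subsetP => _ /imsetP[F + ->].
    rewrite inE => /and4P[Fk bF aF Sk]; rewrite inE Sk shiftK // Fk andbT /=.
    rewrite !inE eqxx /= negb_or negb_and negbK eqxx orTb andbT.
    by apply: contraNneq aF => <-.
  move=> F G; rewrite !inE => /and4P[_ bF aF _] /and4P[_ bG aG _] E.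
  by rewrite -(shiftK aF bF) E shiftK.
by apply/eqP; rewrite eqn_leq !le.
Qed.

(** A facet $G$ adjacent to $F$ arises from exactly one shift: $j$ is the only vertex of $F\setminus
    G$ and $i$ the only vertex of $G\setminus F$. *)
Lemma card_adjacent_facets F : F \in faces K k ->
  (#|adjacent_facets k K F| =
   \sum_i \sum_j [&& j \in F, i \notin F & shift F i j \in faces K k])%N.
Proof.
move=> Fk; have := Fk; rewrite inE => /andP[_ /eqP cF].
rewrite pair_big /=.
pose P := [set p : 'I_n * 'I_n |
  [&& p.2 \in F, p.1 \notin F & shift F p.1 p.2 \in faces K k]].
transitivity #|P|; last first.
  rewrite -sum1_card big_mkcond; apply: eq_bigr => p _.
  by rewrite inE; case: ifP.
rewrite -(card_in_imset (f := fun p => shift F p.1 p.2)); last first.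
  move=> [i j] [i' j']; rewrite !inE /=.
  move=> /and3P[jF iF _] /and3P[jF' iF' _] /setP E; congr pair.
    by have := E i; rewrite !inE eqxx (negPf iF) !andbF !orbF; case: eqVneq.
  have := E j; rewrite !inE eqxx jF !andbT /= orbF.
  case: (eqVneq j j') => // _; rewrite orbT.
  by case: (eqVneq j i) iF => // <-; rewrite jF.
apply: eq_card => G; apply/idP/imsetP; last first.
  case=> -[i j]; rewrite inE /= => /and3P[jF iF Sk] ->.
  rewrite inE Sk /=; apply/andP; split.
    by apply: contraNneq iF => <-; rewrite !inE eqxx.
  apply/eqP; have -> : F :&: shift F i j = F :\ j.
    apply/setP => v; rewrite !inE.
    by case: (eqVneq v i) => [->|_];
      rewrite ?(negPf iF) ?andbF //= andbCA andbb.
  by move: cF; rewrite (cardsD1 j) jF add1n => -[].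
rewrite inE => /and3P[Gk GF /eqP cI].
have := Gk; rewrite inE => /andP[_ /eqP cG].
have /eqP/cards1P[j Ej] : #|F :\: G| = 1%N by rewrite cardsD cI cF subSnn.
have /eqP/cards1P[i Ei] : #|G :\: F| = 1%N.
  by rewrite cardsD setIC cI cG subSnn.
have jFG : j \in F :\: G by rewrite Ej set11.
have iGF : i \in G :\: F by rewrite Ei set11.
have GE : G = shift F i j.
  by rewrite /shift -Ei -Ej setDDr setDv set0U setIC setUC setID.
exists (i, j) => //; rewrite inE /= -GE Gk.
by move: jFG iGF; rewrite !inE => /andP[_ ->] /andP[->].
Qed.

Lemma sum_adjacent_facets :
  (\sum_(F in faces K k) #|adjacent_facets k K F| =
   2 * \sum_(i < n) \sum_(j < n | i < j) successful_shifts K k i j)%N.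
Proof.
transitivity (\sum_i \sum_j successful_shifts K k i j)%N.
  rewrite (eq_bigr _ card_adjacent_facets) /=.
  rewrite exchange_big /=.
  apply: eq_bigr => i _; rewrite exchange_big /=; apply: eq_bigr => j _.
  rewrite /successful_shifts -sum1_card big_mkcond [RHS]big_mkcond /=.
  apply: eq_bigr => F _; rewrite [in RHS]inE.
  by case: (F \in faces K k) => //=; case: ifP.
(* Symmetry folds ordered pairs onto $i<j$ with a factor 2; the diagonal is empty, as no facet both
   contains and avoids $i$. *)
rewrite sum_symmetric; last exact: successful_shiftsC.
rewrite [X in (X + _)%N]big1 // => i _; apply: eq_card0 => F.
by rewrite inE; case: (i \in F); rewrite /= ?andbF.
Qed.

Lemma sum_failed_shifts :
  (\sum_(i < n) \sum_(j < n | i < j) admissible_shifts K k i j =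
   #|failed_shifts K k| +
   \sum_(i < n) \sum_(j < n | i < j) successful_shifts K k i j)%N.
Proof.
have -> : #|failed_shifts K k| =
    (\sum_(i < n) \sum_(j < n) \sum_F ((i, j, F) \in failed_shifts K k))%N.
  rewrite pair_big pair_big /= -sum1_card big_mkcond.
  by apply: eq_bigr => -[[i j] F] _ /=; case: ifP.
rewrite -big_split /=; apply: eq_bigr => i _.
(* Failed triples have $i<j$, so the other half of the sum over $j$ vanishes. *)
rewrite [X in (X + _)%N](bigID (fun j : 'I_n => (i < j)%N)) /=.
rewrite [X in (_ + X + _)%N]big1 ?addn0; last first.
  by move=> j ij; apply: big1 => F _; rewrite inE (negPf ij).
rewrite -big_split /=; apply: eq_bigr => j ij.
rewrite /admissible_shifts /successful_shifts -!sum1_card.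
rewrite big_mkcond [X in (_ + X)%N]big_mkcond -big_split /=.
apply: eq_bigr => F _; rewrite !inE ij.
case: (F \in K) => //=; case: (#|F| == _) => //=.
by case: (j \in F); case: (i \in F) => //=; case: (_ && _).
Qed.

End FacetCounts.

(* The sum over r >= 1 is truncated at the number of facets, which bounds all
   degrees: [vdeg_conj K k r] vanishes for larger r. *)
Theorem theorem3p9 (R : rcfType) (n k : nat) (K : {set {set 'I_n}})
    (o : {set 'I_n} -> seq 'I_n)
    (k_ge1 : (1 <= k)%N)
    (K_complex : simplicial_complex K)
    (K_dim : has_dimension K k)
    (K_pure : pure K k)
    (o_orient : is_orientation K o)
    (deg_sorted : forall i j : 'I_n, (i <= j)%N -> (vdeg K k j <= vdeg K k i)%N) :
  let second_moment_gap : R :=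
    \sum_(1 <= r < #|faces K k|.+1) (vdeg_conj K k r)%:R ^+ 2
    - \sum_(lambda <- nonzero_eigenvalues (up_laplacian R K o k)) lambda ^+ 2 in
  second_moment_gap =
    2 * (\sum_(i < n) \sum_(j < n | (i < j)%N)
          ((admissible_shifts K k i j)%:R - (successful_shifts K k i j)%:R))
  /\ second_moment_gap = 2 * #|failed_shifts K k|%:R.
Proof.
have L_sym : (up_laplacian R K o k)^T = up_laplacian R K o k.
  by rewrite trmx_mul trmxK.
have gapE : \sum_(1 <= r < #|faces K k|.+1) (vdeg_conj K k r)%:R ^+ 2
    - \sum_(lambda <- nonzero_eigenvalues (up_laplacian R K o k)) lambda ^+ 2
    = 2 * #|failed_shifts K k|%:R :> R.
  rewrite sum_sqr_nonzero_eigenvalues // trace_up_laplacian_sqr //.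
  under [X in X - _]eq_bigr => r _ do rewrite -natrX.
  (* Both moments contain $(k+1)^2f$, which cancels together with twice the successful shifts. *)
  rewrite -natr_sum sum_vdeg_conj_sqr_sorted // sum_adjacent_facets.
  by rewrite sum_failed_shifts mulnDr addnCA natrD addrK natrM.
split=> //; rewrite gapE; congr (2 * _).
under eq_bigr => i _ do rewrite sumrB -!natr_sum.
by rewrite sumrB -!natr_sum sum_failed_shifts natrD addrK.
Qed.
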